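(* Let $\lambda\in\mathbb{R}$, let $Y$ be a Poisson random variable with parameter $\alpha>0$, and let $x\in[0,1]$. For all integers $n\ge k\ge 0$, \[ \frac{B_{k,n}^{Y}(x|\lambda)}{k!}=\binom{x}{k}_{\lambda}\binom{n}{k}\phi_{n-k,\lambda}\big(\alpha(1-x)\big). \]
   Context: For $\lambda\in\mathbb{R}$, $(x)_{0,\lambda}=1$, $(x)_{n,\lambda}=x(x-\lambda)\cdots(x-(n-1)\lambda)$ for $n\ge1$, $\binom{x}{k}_\lambda=\frac{(x)_{k,\lambda}}{k!}$, and $e_\lambda^x(t)=\sum_{n\ge0}(x)_{n,\lambda}\frac{t^n}{n!}$, $e_\lambda(t)=e_\lambda^1(t)$. The degenerate Stirling numbers of the second kind are given by $(x)_{n,\lambda}=\sum_{k=0}^n{n\brace k}_\lambda (x)_k$, where $(x)_k=x(x-1)\cdots(x-k+1)$; the degenerate Bell polynomials are $\phi_{n,\lambda}(x)=\sum_{k=0}^n{n\brace k}_\lambda x^k$. For the random variable $Y$, $E[e_\lambda^Y(t)]$ denotes the power series $\sum_{n\ge0}E[(Y)_{n,\lambda}]\frac{t^n}{n!}$ (constant term $1$); for real $a$, $(E[e_\lambda^Y(t)])^a=\sum_{j\ge0}\binom{a}{j}(E[e_\lambda^Y(t)]-1)^j$. The probabilistic degenerate Bernstein polynomials: $\frac{1}{k!}(x)_{k,\lambda}t^k(E[e_\lambda^Y(t)])^{1-x}=\sum_{n\ge k}B_{k,n}^{Y}(x|\lambda)\frac{t^n}{n!}$. *)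

(* Defs.v *)
From HB Require Import structures.
From mathcomp Require Import all_boot all_order all_algebra.
From mathcomp Require Import all_classical all_reals all_analysis.

Set Implicit Arguments.
Unset Strict Implicit.
Unset Printing Implicit Defensive.

Import Order.TTheory GRing.Theory Num.Theory.
Import numFieldNormedType.Exports.

Local Open Scope classical_set_scope.
Local Open Scope ring_scope.

Section degenerate_numbers.
Context {R : realType}.
Implicit Types (lambda x : R) (n k : nat).

(* (x)_k = x (x - 1) ... (x - k + 1) *)
Definition falling x k : R := \prod_(i < k) (x - i%:R).

(* (x)_{n,lambda} = x (x - lambda) ... (x - (n - 1) lambda) *)
Definition dfalling lambda x n : R := \prod_(i < n) (x - i%:R * lambda).

Definition gbinom x k : R := falling x k / k`!%:R.

Definition dbinom lambda x k : R := dfalling lambda x k / k`!%:R.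

Definition dstirling2_spec lambda (S : nat -> nat -> R) : Prop :=
  (forall n x, dfalling lambda x n = \sum_(k < n.+1) S n k * falling x k) /\
  (forall n k, (n < k)%N -> S n k = 0).

Lemma dstirling2_exists lambda : exists S, dstirling2_spec lambda S.
Proof.
pose S := fix S n k : R := match n, k with
  | 0%N, 0%N => 1
  | 0%N, _.+1 => 0
  | n'.+1, 0%N => - (n'%:R * lambda) * S n' 0%N
  | n'.+1, k'.+1 => S n' k' + (k'.+1%:R - n'%:R * lambda) * S n' k'.+1
  end.
have S0 n k : (n < k)%N -> S n k = 0.
  elim: n k => [|n IHn] [|k] //= nk.
  by rewrite !IHn ?mulr0 ?addr0// ltnW.
exists S; split=> // n x; elim: n => [|n IHn].
  by rewrite /dfalling /falling big_ord0 big_ord1 big_ord0 mulr1.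
rewrite /dfalling big_ord_recr /= -/(dfalling lambda x n) IHn mulr_suml.
pose a k := (k%:R - n%:R * lambda) * S n k * falling x k.
have -> : \sum_(k < n.+1) S n k * falling x k * (x - n%:R * lambda) =
    \sum_(k < n.+1) S n k * falling x k.+1 + \sum_(k < n.+1) a k.
  rewrite -big_split /=; apply: eq_bigr => k _.
  rewrite /a /falling big_ord_recr /= -/(falling x k).
  rewrite -[x - n%:R * lambda](subrKA k%:R) mulrDr; congr (_ + _).
    by rewrite mulrA.
  by rewrite mulrC mulrA.
have -> : \sum_(k < n.+1) a k = a 0%N + \sum_(k < n.+1) a k.+1.
  rewrite big_ord_recl /= [in RHS]big_ord_recr /=.
  by have -> : a n.+1 = 0; rewrite ?addr0// /a S0// mulr0 mul0r.
rewrite [RHS]big_ord_recl /= /a sub0r [LHS]addrCA; congr (_ + _).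
by rewrite -big_split; apply: eq_bigr => k _ /=; rewrite -mulrDl.
Qed.

(* The defining expansion determines S n k for k <= n, as the falling          *)
(* factorials are linearly independent.                                        *)
Definition dstirling2 lambda : nat -> nat -> R :=
  sval (cid (dstirling2_exists lambda)).

Lemma dstirling2P lambda : dstirling2_spec lambda (dstirling2 lambda).
Proof. exact: svalP. Qed.

Definition dbell lambda n x : R :=
  \sum_(k < n.+1) dstirling2 lambda n k * x ^+ k.

End degenerate_numbers.

(* A formal power series in t is the sequence of its coefficients:             *)
(* f n is the coefficient of t^n (not of t^n/n!).                              *)
Section formal_power_series.
Context {R : realType}.
Implicit Types (f g : nat -> R) (a : R).

Definition fps_one : nat -> R := fun n => (n == 0%N)%:R.

Definition fps_sub f g : nat -> R := fun n => f n - g n.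

Definition fps_scale a f : nat -> R := fun n => a * f n.

Definition fps_mul f g : nat -> R := fun n => \sum_(i < n.+1) f i * g (n - i)%N.

Definition fps_exp f j : nat -> R := iter j (fps_mul f) fps_one.

(* t^k *)
Definition fps_monom k : nat -> R := fun n => (n == k)%:R.

(* f^a = \sum_(j >= 0) gbinom a j (f - 1)^j for f with constant term 1: by      *)
(* fps_exp_sub1_eq0, only the terms j <= n contribute to the coefficient of    *)
(* t^n.                                                                        *)
Definition fps_powr f a : nat -> R :=
  fun n => \sum_(j < n.+1) gbinom a j * fps_exp (fps_sub f fps_one) j n.

Lemma fps_exp_sub1_eq0 f j n :
  f 0%N = 1 -> (n < j)%N -> fps_exp (fps_sub f fps_one) j n = 0.
Proof.
move=> f0; elim: j n => // j IHj n nj.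
rewrite /fps_exp iterS -/(fps_exp _ j) /fps_mul big1 // => -[[|i] /= lti] _.
  by rewrite /fps_sub /fps_one f0 subrr mul0r.
rewrite IHj ?mulr0//.
case: n nj lti => // n nj _; rewrite subSS.
exact: leq_ltn_trans (leq_subr _ _) _.
Qed.

End formal_power_series.

Section bernstein.
Context {d : measure_display} {T : measurableType d} {R : realType}.
Context {P : probability T R}.
Implicit Types (Y : {RV P >-> R}) (lambda x : R).

(* P(Y = m) = alpha^m / m! * e^(-alpha) for all m *)
Definition is_poisson (alpha : R) Y : Prop :=
  forall m : nat, pmf Y m%:R = poisson_pmf alpha m.

(* E[e_lambda^Y(t)] = \sum_n E[(Y)_{n,lambda}] t^n / n!; fine loses nothing     *)
(* when Y has finite moments, as a Poisson variable does.                      *)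
Definition expected_dexp lambda Y : nat -> R :=
  fun n => fine 'E_P[fun w => dfalling lambda (Y w) n] / n`!%:R.

(* (1/k!) (x)_{k,lambda} t^k (E[e_lambda^Y(t)])^(1 - x) *)
Definition bernstein_gf lambda Y k x : nat -> R :=
  fps_scale (dfalling lambda x k / k`!%:R)
    (fps_mul (fps_monom k) (fps_powr (expected_dexp lambda Y) (1 - x))).

(* B_{k,n}^Y(x|lambda) *)
Definition pdbernstein lambda Y k n x : R := n`!%:R * bernstein_gf lambda Y k x n.

End bernstein.

(* Main.v *)
(* The factorial moments E[(Y)_k] = alpha^k of the Poisson law and the         *)
(* expansion of (Y)_{n,lambda} in falling factorials give                      *)
(* E[(Y)_{n,lambda}] = phi_{n,lambda}(alpha). The Bell polynomials satisfy     *)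
(* phi_{n+1}(x) = x phi_n(x) + x phi_n'(x) - n lambda phi_n(x), from which     *)
(* they are of binomial type: their exponential generating series G_x(t)       *)
(* satisfies G_{x+y} = G_x G_y. So G_alpha^N = G_{N alpha} for natural N, and   *)
(* this extends to every real exponent because each coefficient of both sides  *)
(* is a polynomial in the exponent. Multiplication by t^k then only shifts the *)
(* index.                                                                      *)

Require Import Defs.
From HB Require Import structures.
From mathcomp Require Import all_boot all_order all_algebra.
From mathcomp Require Import all_classical all_reals all_analysis.
From mathcomp Require Import measurable_realfun ring.

Import Order.TTheory GRing.Theory Num.Theory.
Import numFieldNormedType.Exports.

Local Open Scope ring_scope.

(** Behind the computation stands G_x(t) = exp(x (e_lambda(t) - 1)): a power of G_alpha only
    rescales alpha. The exponential itself is never formed. [expectation_dfalling_poisson]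
    identifies E[e_lambda^Y(t)] with G_alpha, [dbell_polyD] gives the binomial type, and
    [fps_powr_dbell] passes from natural to real exponents. *)

(** * Recurrence and binomial type of the degenerate Bell polynomials *)

Section degenerate_bell.
Context {R : realType}.
Implicit Types (lambda p q x : R) (n k : nat).

Lemma falling_natr (m k : nat) : falling m%:R k = (m ^_ k)%:R :> R.
Proof.
elim: k => [|k IHk]; first by rewrite /falling big_ord0.
rewrite /falling big_ord_recr /= -/(falling _ _) IHk ffactnSr natrM.
have [km|mk] := leqP k m; first by rewrite natrB.
by rewrite ffact_small// !mul0r.
Qed.

Lemma gbinom_natr (m k : nat) : gbinom m%:R k = 'C(m, k)%:R :> R.
Proof.
by rewrite /gbinom falling_natr -bin_ffact natrM mulfK// pnatr_eq0 -lt0n fact_gt0.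
Qed.

(** Evaluation at x = 0, 1, ..., n is triangular: [falling k%:R i] vanishes for i > k and equals k!
    for i = k, so the coefficients vanish one after another. *)
Lemma falling_free n (c : nat -> R) :
  (forall x, \sum_(k < n.+1) c k * falling x k = 0) ->
  forall k, (k <= n)%N -> c k = 0.
Proof.
move=> c0; elim/ltn_ind => k IHk kn.
have := c0 k%:R; rewrite (bigD1 (inord k)) //= inordK// big1 ?addr0 => [|i].
  rewrite falling_natr ffactnn => /eqP.
  by rewrite mulf_eq0 pnatr_eq0 (gtn_eqF (fact_gt0 k)) orbF => /eqP.
rewrite -val_eqE /= inordK// neq_ltn => /orP[ik|ki].
  by rewrite IHk ?mul0r// (leq_trans (ltnW ik)).
by rewrite falling_natr ffact_small// mulr0.
Qed.

Lemma dstirling2_small lambda n k : (n < k)%N -> dstirling2 lambda n k = 0.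
Proof. by case: (dstirling2P lambda) => _; apply. Qed.

Lemma dfalling_dstirling2 lambda x n :
  dfalling lambda x n = \sum_(k < n.+1) dstirling2 lambda n k * falling x k.
Proof. by case: (dstirling2P lambda). Qed.

Lemma dstirling200 lambda : dstirling2 lambda 0 0 = 1.
Proof.
have := dfalling_dstirling2 lambda 0 0.
by rewrite /dfalling /falling big_ord_recl !big_ord0 mulr1 addr0.
Qed.

(** As [dstirling2] is chosen from an existence statement, its recurrence is recovered by comparing
    coefficients of falling factorials, with x - n lambda = (x - k) + (k - n lambda). *)
Lemma dstirling2S lambda n k : dstirling2 lambda n.+1 k =
  (if k is k'.+1 then dstirling2 lambda n k' else 0) +
  (k%:R - n%:R * lambda) * dstirling2 lambda n k.
Proof.
have [kn|nk] := leqP k n.+1; last first.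
  case: k nk => // k nk.
  by rewrite !dstirling2_small ?mulr0 ?addr0// ltnW.
apply/eqP; rewrite -subr_eq0; apply/eqP; move: k kn.
set S := dstirling2 lambda.
apply: (falling_free n.+1 (fun k => S n.+1 k -
  ((if k is k'.+1 then S n k' else 0) + (k%:R - n%:R * lambda) * S n k))) => x.
under eq_bigr do rewrite mulrBl mulrDl.
rewrite sumrB big_split /= -dfalling_dstirling2.
rewrite [in X in _ - (X + _)]big_ord_recl /= mul0r add0r.
have Snn : S n n.+1 = 0 by exact: dstirling2_small.
rewrite [in X in _ - (_ + X)]big_ord_recr /= Snn mulr0 mul0r addr0.
rewrite -big_split /= /dfalling big_ord_recr /= -/(dfalling _ _ _).
apply/eqP; rewrite subr_eq0; apply/eqP.
rewrite dfalling_dstirling2 mulr_suml; apply: eq_bigr => k _.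
by rewrite /falling /bump /= add1n big_ord_recr /= -/(falling _ _) -/S; ring.
Qed.

(* phi_n(p X): with the dilation factor p, the values at p, q and p + q become *)
(* polynomials in one variable, on which X d/dX acts as a derivation.          *)
Definition dbell_poly lambda p n : {poly R} :=
  \poly_(k < n.+1) (dstirling2 lambda n k * p ^+ k).

Lemma coef_dbell_poly lambda p n k :
  (dbell_poly lambda p n)`_k = dstirling2 lambda n k * p ^+ k.
Proof.
rewrite coef_poly; case: ltnP => // nk.
by rewrite dstirling2_small// mul0r.
Qed.

Lemma horner_dbell_poly lambda p n x :
  (dbell_poly lambda p n).[x] = dbell lambda n (p * x).
Proof.
rewrite horner_poly; apply: eq_bigr => k _.
by rewrite exprMn mulrA.
Qed.

Lemma dbell_poly0 lambda p : dbell_poly lambda p 0 = 1.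
Proof.
apply/polyP => k; rewrite coef_dbell_poly coef1.
case: k => [|k]; first by rewrite dstirling200 mulr1.
by rewrite dstirling2_small// mul0r.
Qed.

Lemma dbell_polyS lambda p n : dbell_poly lambda p n.+1 =
  p *: ('X * dbell_poly lambda p n) + 'X * (dbell_poly lambda p n)^`() -
  (n%:R * lambda) *: dbell_poly lambda p n.
Proof.
apply/polyP => k; rewrite coefB coefD !coefZ !coefXM coef_deriv.
rewrite !coef_dbell_poly dstirling2S; case: k => [|k] /=; first by ring.
by rewrite exprS -mulr_natr; ring.
Qed.

(** Both sides obey the same recurrence in n: X d/dX satisfies the product rule, while the factors
    (p + q) X and n lambda split additively over the two factors of each product. *)
Lemma dbell_polyD lambda p q n : (n`!%:R)^-1 *: dbell_poly lambda (p + q) n =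
  \sum_(i < n.+1) ((i`!%:R)^-1 *: dbell_poly lambda p i) *
                  (((n - i)`!%:R)^-1 *: dbell_poly lambda q (n - i)).
Proof.
pose g p i := (i`!%:R)^-1 *: dbell_poly lambda p i.
have gS r i : i.+1%:R *: g r i.+1 =
    r *: ('X * g r i) + 'X * (g r i)^`() - (i%:R * lambda) *: g r i.
  rewrite /g scalerA factS natrM invfM mulrA mulfV ?pnatr_eq0// mul1r.
  rewrite dbell_polyS derivZ !scalerBr !scalerDr -!scalerAr !scalerA.
  by rewrite ![(i`!%:R)^-1 * _]mulrC.
rewrite -/(g (p + q) n) -[RHS]/(\sum_(i < n.+1) g p i * g q (n - i)%N).
have g0 r : g r 0 = 1 by rewrite /g dbell_poly0 fact0 invr1 scale1r.
move: g gS g0 => {}g gS g0; elim: n => [|n IHn].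
  by rewrite big_ord1 !g0 mulr1.
have n0 : n.+1%:R != 0 :> R by rewrite pnatr_eq0.
apply: (scalerI n0); rewrite gS IHn.
(* Product rule for d/dt on coefficients: n + 1 = i + (n + 1 - i), and the end term with factor 0
   drops from each sum. *)
have -> : n.+1%:R *: (\sum_(i < n.+2) g p i * g q (n.+1 - i)%N) =
    \sum_(i < n.+1) ((i.+1%:R *: g p i.+1) * g q (n - i)%N +
                     g p i * ((n - i).+1%:R *: g q (n - i).+1)).
  have -> : n.+1%:R *: (\sum_(i < n.+2) g p i * g q (n.+1 - i)%N) =
      \sum_(i < n.+2) (i%:R *: g p i) * g q (n.+1 - i)%N +
      \sum_(i < n.+2) g p i * ((n.+1 - i)%:R *: g q (n.+1 - i)%N).
    rewrite -big_split scaler_sumr; apply: eq_bigr => i _ /=.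
    rewrite -scalerAl -scalerAr -scalerDl -natrD subnKC//.
    by rewrite -ltnS.
  rewrite big_ord_recl /= scale0r mul0r add0r.
  rewrite [X in _ + X]big_ord_recr /= subnn scale0r mulr0 addr0 -big_split /=.
  by apply: eq_bigr => i _; rewrite /bump /= add1n subSS subSn// -ltnS.
rewrite mulr_sumr (linear_sum (@deriv R)) !mulr_sumr !scaler_sumr -big_split -sumrB /=.
apply: eq_bigr => i _; rewrite !gS derivM.
have -> : n%:R = i%:R + (n - i)%:R :> R by rewrite -natrD subnKC// -ltnS.
rewrite -!mul_polyC !polyCM !polyCD /=; ring.
Qed.

End degenerate_bell.

(** * Natural and real powers of power series *)

Section formal_powers.
Context {R : realType}.
Implicit Types (f g : nat -> R) (n : nat).

Lemma fps_expS f j : fps_exp f j.+1 = fps_mul f (fps_exp f j).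
Proof. by rewrite /fps_exp iterS. Qed.

Lemma fps_mul_subl f g n :
  fps_mul f g n = g n + fps_mul (fps_sub f fps_one) g n.
Proof.
have -> : g n = fps_mul fps_one g n.
  rewrite /fps_mul big_ord_recl /= /fps_one eqxx mul1r subn0 big1 ?addr0//.
  by move=> i _; rewrite mul0r.
rewrite /fps_mul -big_split; apply: eq_bigr => i _ /=.
by rewrite /fps_sub; ring.
Qed.

(** Binomial theorem for (1 + u)^N. The cutoff [M] is independent of [n] because the induction needs
    one cutoff for all lower coefficients. *)
Lemma fps_exp_binomial f (N M n : nat) : f 0%N = 1 -> (n < M)%N ->
  fps_exp f N n = \sum_(j < M) 'C(N, j)%:R * fps_exp (fps_sub f fps_one) j n.
Proof.
move=> f0; set u := fps_sub f fps_one.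
elim: N M n => [|N IHN] [//|M] n nM.
  rewrite big_ord_recl bin0 mul1r big1 ?addr0// => i _.
  by rewrite bin0n mul0r.
have -> : fps_exp f N.+1 n = fps_exp f N n +
    \sum_(j < M.+1) 'C(N, j)%:R * fps_exp u j.+1 n.
  rewrite fps_expS fps_mul_subl -/u; congr (_ + _).
  under [RHS]eq_bigr do rewrite fps_expS mulr_sumr.
  rewrite exchange_big /=; apply: eq_bigr => i _.
  rewrite (IHN M.+1); last exact: leq_ltn_trans (leq_subr _ _) nM.
  by rewrite mulr_sumr; apply: eq_bigr => j _; rewrite mulrCA.
have uM : fps_exp u M.+1 n = 0 by exact: fps_exp_sub1_eq0.
rewrite (IHN _ _ nM) [X in _ + X]big_ord_recr [in X in _ + X]uM mulr0.
rewrite [X in _ + X]addr0 big_ord_recl [RHS]big_ord_recl !bin0 -addrA.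
congr (_ + _); rewrite -big_split; apply: eq_bigr => j _ /=.
by rewrite /bump /= add1n binS natrD mulrDl.
Qed.

Lemma fps_powr_natr f (N : nat) : f 0%N = 1 -> fps_powr f N%:R = fps_exp f N.
Proof.
move=> f0; apply/funext => n; rewrite (fps_exp_binomial f N n.+1)//.
by apply: eq_bigr => j _; rewrite gbinom_natr.
Qed.

Lemma poly_nat_roots0 (p : {poly R}) : (forall N : nat, p.[N%:R] = 0) -> p = 0.
Proof.
move=> p0; apply/eqP; apply: contraT => pn0.
have := max_poly_roots (rs := [seq N%:R | N <- iota 0 (size p)]) pn0.
rewrite size_map size_iota ltnn; apply.
  by apply/allP => _ /mapP[N _ ->]; apply/rootP.
by rewrite map_inj_uniq ?iota_uniq//; exact: mulrIn (oner_neq0 _).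
Qed.

Lemma fps_mul_dbell (lambda p q : R) :
  fps_mul (fun i => dbell lambda i p / i`!%:R)
          (fun i => dbell lambda i q / i`!%:R) =
  (fun i => dbell lambda i (p + q) / i`!%:R).
Proof.
(* At X = 1 the dilated polynomials take the values at p, q and p + q. *)
apply/funext => n; have /(congr1 (horner^~ 1)) := dbell_polyD lambda p q n.
rewrite hornerZ horner_sum horner_dbell_poly mulr1 mulrC => ->.
apply: eq_bigr => i _; rewrite hornerM !hornerZ !horner_dbell_poly !mulr1.
by rewrite ![_^-1 * _]mulrC.
Qed.

Lemma dbell_at0 (lambda : R) n : dbell lambda n 0 = (n == 0)%:R.
Proof.
rewrite /dbell big_ord_recl mulr1 big1 ?addr0; last first.
  by move=> i _; rewrite expr0n mulr0.
elim: n => [|n IHn]; first by rewrite dstirling200.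
rewrite dstirling2S IHn; case: n {IHn} => [|n]; rewrite ?mulr0 ?addr0//.
by rewrite mul0r subrr mul0r addr0.
Qed.

Lemma fps_exp_dbell (lambda p : R) N :
  fps_exp (fun i => dbell lambda i p / i`!%:R) N =
  (fun i => dbell lambda i (p * N%:R) / i`!%:R).
Proof.
elim: N => [|N IHN].
  apply/funext => -[|n]; rewrite mulr0 dbell_at0 /fps_exp /fps_one /=.
    by rewrite fact0 divr1.
  by rewrite mul0r.
by rewrite fps_expS IHN fps_mul_dbell mulrS mulrDr mulr1.
Qed.

(* Both sides are polynomials in a, and they agree at every natural number. *)
Lemma fps_powr_dbell (lambda p a : R) :
  fps_powr (fun i => dbell lambda i p / i`!%:R) a =
  (fun i => dbell lambda i (p * a) / i`!%:R).
Proof.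
apply/funext => n; set f := fun i => _.
have f0 : f 0%N = 1.
  by rewrite /f /dbell big_ord1 dstirling200 mulr1 fact0 divr1.
pose c j := fps_exp (fps_sub f fps_one) j n.
(* The t^n coefficient of f^X as a polynomial in the exponent X; the [c j] do not involve it. *)
pose F : {poly R} := \sum_(j < n.+1)
  (c j / j`!%:R) *: \prod_(i < j) ('X - i%:R%:P).
have FE b : F.[b] = fps_powr f b n.
  rewrite horner_sum; apply: eq_bigr => j _.
  rewrite hornerZ horner_prod /gbinom -/(c j) /falling.
  by under eq_bigr do rewrite hornerXsubC; ring.
have : F - (n`!%:R)^-1 *: dbell_poly lambda p n = 0.
  apply: poly_nat_roots0 => N.
  rewrite hornerD hornerN FE hornerZ horner_dbell_poly fps_powr_natr//.
  by rewrite fps_exp_dbell mulrC subrr.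
move=> /(congr1 (horner^~ a)) /eqP.
rewrite hornerD hornerN FE hornerZ horner_dbell_poly horner0 subr_eq0 => /eqP ->.
by rewrite mulrC.
Qed.

End formal_powers.

(** * Factorial moments of a Poisson variable *)

Lemma measurable_falling {R : realType} (k : nat) :
  measurable_fun setT (fun r : R => falling r k).
Proof.
by apply: measurable_prod => i _; exact: measurable_funB.
Qed.

Section poisson_moments.
Context {d : measure_display} {T : measurableType d} {R : realType}.
Context {P : probability T R}.
Context (alpha : R) (Y : {RV P >-> R}).
Context (alpha_gt0 : 0 < alpha) (Y_poisson : is_poisson alpha Y).
Local Open Scope classical_set_scope.

Lemma poisson_pmf_sum : (\sum_(m <oo) (poisson_pmf alpha m)%:E = 1)%E.
Proof.
rewrite nneseries_esumT; last by move=> m; rewrite lee_fin poisson_pmf_ge0.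
have := @probability_setT _ _ _ (poisson_prob alpha 0).
by rewrite /= /poisson_prob alpha_gt0.
Qed.

Lemma poisson_pmf_ffact_sum (k : nat) :
  (\sum_(m <oo) ((m ^_ k)%:R * poisson_pmf alpha m)%:E = (alpha ^+ k)%:E)%E.
Proof.
have f0 m : (0 <= ((m ^_ k)%:R * poisson_pmf alpha m)%:E)%E.
  by rewrite lee_fin mulr_ge0// poisson_pmf_ge0.
rewrite (nneseries_split 0 k)// add0n big_nat_cond big1 ?add0e; last first.
  by move=> m; rewrite andbT => /= mk; rewrite ffact_small// mul0r.
rewrite -nneseries_addn//.
(* The terms below k are zero; after the shift by k, the factor alpha^k comes out and the total mass
   1 remains. *)
under eq_eseriesr => m _.
  have -> : ((m + k) ^_ k)%:R * poisson_pmf alpha (m + k) =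
      alpha ^+ k * poisson_pmf alpha m.
    rewrite /poisson_pmf alpha_gt0 -(ffact_fact (leq_addl m k)) addnK natrM.
    have mf : m`!%:R != 0 :> R by rewrite pnatr_eq0 -lt0n fact_gt0.
    have kf : ((m + k) ^_ k)%:R != 0 :> R.
      by rewrite pnatr_eq0 -lt0n ffact_gt0 leq_addl.
    by rewrite exprD; field; rewrite mf kf.
  rewrite EFinM; over.
rewrite /= nneseriesZl; last by move=> m _; rewrite lee_fin poisson_pmf_ge0.
by rewrite poisson_pmf_sum mule1.
Qed.

Let F (m : nat) := Y @^-1` [set m%:R].

Let mF m : measurable (F m).
Proof. exact: measurable_funPTI. Qed.

Let tF : trivIset setT F.
Proof.
move=> i j _ _ [w [Yi Yj]].
by apply/eqP; rewrite -(eqr_nat R) -[i%:R]Yi -[j%:R]Yj.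
Qed.

Let PF m : P (F m) = (poisson_pmf alpha m)%:E.
Proof. by rewrite -Y_poisson /pmf fineK// fin_num_measure. Qed.

Let mUF : measurable (\bigcup_m F m).
Proof. exact: bigcup_measurable. Qed.

(** [is_poisson] fixes only the masses at the naturals; these already sum to 1, so nothing is left
    elsewhere. *)
Lemma poisson_nat_ae : P (~` \bigcup_m F m) = 0%E.
Proof.
rewrite probability_setC// measure_bigcup//.
under eq_eseriesl do rewrite in_setT.
by rewrite (eq_eseriesr (fun m _ => PF m)) poisson_pmf_sum subee.
Qed.

Lemma ge0_integral_poisson (h : R -> R) :
  measurable_fun setT h -> (forall r, 0 <= h r) ->
  (\int[P]_w (h (Y w))%:E =
   \sum_(m <oo) (h m%:R * poisson_pmf alpha m)%:E)%E.
Proof.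
move=> mh h0.
have /measurable_EFinP mhY : measurable_fun setT (h \o Y).
  exact: measurableT_comp.
have hY0 w : (0 <= (h (Y w))%:E)%E by rewrite lee_fin.
rewrite (@ge0_negligible_integral _ _ _ P setT (~` \bigcup_m F m))//;
    last 2 first.
- exact: measurableC.
- exact: poisson_nat_ae.
rewrite setTD setCK ge0_integral_bigcup//; last exact: measurable_funTS.
apply: eq_eseriesr => m _; rewrite EFinM -PF.
rewrite -integral_cst//; apply: eq_integral => w; rewrite inE => /= Yw.
by rewrite Yw.
Qed.

Lemma poisson_falling_integrable (k : nat) :
  P.-integrable setT (fun w => (falling (Y w) k)%:E).
Proof.
apply/integrableP; split.
  by apply/measurable_EFinP; apply: (measurableT_comp (measurable_falling k)).
under eq_integral do rewrite abse_EFin.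
rewrite (ge0_integral_poisson (fun r => `|falling r k|)) //.
  by under eq_eseriesr do rewrite falling_natr normr_nat;
     rewrite poisson_pmf_ffact_sum ltry.
by apply: measurableT_comp => //; exact: measurable_falling.
Qed.

Lemma poisson_falling_moment (k : nat) :
  (\int[P]_w (falling (Y w) k)%:E = (alpha ^+ k)%:E)%E.
Proof.
have mf : measurable_fun setT (fun r : R => `|falling r k|).
  by apply: measurableT_comp => //; exact: measurable_falling.
(* [falling r k] may be negative at non-natural r, so the formula for nonnegative functions is
   applied to its absolute value, which agrees almost everywhere. *)
transitivity (\int[P]_w (`|falling (Y w) k|)%:E)%E.
  apply: ae_eq_integral => //.
  - by case/integrableP : (poisson_falling_integrable k).
  - apply/measurable_EFinP; exact: (measurableT_comp mf).
  - exists (~` \bigcup_m F m); split; first exact: measurableC.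
      exact: poisson_nat_ae.
    apply: subsetC => w [m _ /= ->] _.
    by rewrite falling_natr normr_nat.
rewrite (ge0_integral_poisson (fun r => `|falling r k|)) //.
by under eq_eseriesr do rewrite falling_natr normr_nat;
   rewrite poisson_pmf_ffact_sum.
Qed.

Lemma expectation_dfalling_poisson (lambda : R) (n : nat) :
  'E_P[fun w => dfalling lambda (Y w) n]%E = (dbell lambda n alpha)%:E.
Proof.
rewrite unlock.
under eq_integral do rewrite dfalling_dstirling2 -sumEFin.
rewrite integral_sum//=; last first.
  move=> k; under eq_fun do rewrite EFinM.
  by apply: integrableZl => //; exact: poisson_falling_integrable.
rewrite /dbell -sumEFin; apply: eq_bigr => k _.
under eq_integral do rewrite EFinM.
rewrite integralZl//; last exact: poisson_falling_integrable.
by rewrite poisson_falling_moment.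
Qed.

End poisson_moments.

Theorem theorem2p8 (d : measure_display) (T : measurableType d) (R : realType)
    (P : probability T R) (lambda alpha : R) (Y : {RV P >-> R}) (x : R)
    (alpha_gt0 : 0 < alpha) (Y_poisson : is_poisson alpha Y)
    (x01 : 0 <= x <= 1) (n k : nat) (lekn : (k <= n)%N) :
  pdbernstein lambda Y k n x / k`!%:R =
  dbinom lambda x k * 'C(n, k)%:R * dbell lambda (n - k) (alpha * (1 - x)).
Proof.
rewrite /pdbernstein /bernstein_gf /fps_scale /dbinom.
have -> : expected_dexp lambda Y = (fun i => dbell lambda i alpha / i`!%:R).
  apply/funext => i; rewrite /expected_dexp.
  by rewrite (expectation_dfalling_poisson alpha Y alpha_gt0 Y_poisson).
(* Only the index k survives in the product with t^k, and it lies in range since k <= n. *)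
rewrite fps_powr_dbell /fps_mul (bigD1 (inord k)) //= inordK ?ltnS// big1.
  rewrite /fps_monom eqxx mul1r addr0 -(bin_fact lekn) !natrM.
  have kf : k`!%:R != 0 :> R by rewrite pnatr_eq0 -lt0n fact_gt0.
  have nkf : (n - k)`!%:R != 0 :> R by rewrite pnatr_eq0 -lt0n fact_gt0.
  by field; rewrite kf nkf.
move=> i; rewrite -val_eqE /= inordK ?ltnS// => /negbTE ik.
by rewrite /fps_monom ik mul0r.
Qed.
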